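(* Let $M\subset\mathbb{R}^m$ be open. For $i=1,\dots,n$ let $P_i$ be a one-dimensional probability density function on a domain $X_i\subset\mathbb{R}$, let $h^i:M\to\mathbb{R}$ be differentiable, let $e_i\in\mathbb{N}^{+}$, and suppose that $X_i$ is unchanged under the change of variables $y^i=x^ie^{h^i(\theta)}$ for all $i$ and all $\theta\in M$. Then the family $$P(x;\theta)=\bigodot_{i=1}^n \Big(e^{h^i(\theta)}P_i\big(x^ie^{h^i(\theta)}\big)\Big)^{\odot e_i}$$ has Fisher information metric $$g_{ab}(P)=\sum_{i,j=1}^n(\partial_a h^i)(\partial_b h^j)E_{ij},$$ where $$E_{ij}=\begin{cases} e_i\displaystyle\int_{X_i}P_i(x^i)\Big(1+x^i\frac{\partial\ln P_i(x^i)}{\partial x^i}\Big)^2\mathrm{d}x^i, & i=j,\\ 0, & i\neq j.\end{cases}$$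
   Context: Here $\partial_a=\partial/\partial\theta^a$ for coordinates $\theta=(\theta^1,\dots,\theta^m)$ on $M$. A domain in $\mathbb{R}$ is a nonempty connected open set. A one-dimensional probability density function on $X_i$ is a nonnegative function on $X_i$ with integral $1$; here each $P_i$ is continuously differentiable on $X_i$, and the integrals defining $E_{ii}$ are assumed finite. The Fisher information metric of a family $P(x;\theta)$, $x\in X$, $\theta\in M$, of probability density functions is $$g_{ab}(P)(\theta)=\int_X P(x;\theta)\,\partial_a\ln P(x;\theta)\,\partial_b\ln P(x;\theta)\,\mathrm{d}x .$$ Integrands containing a logarithmic derivative of a density are taken to be $0$ where that density vanishes. The spatially disjoint product $\bigodot$ of families of densities over the same parameter set $M$ is the product of the densities in separate spatial variables, and $Q^{\odot e}$ is the spatially disjoint product of $e$ copies of $Q$. Thus here, explicitly, with variables $x^{i,k}\in X_i$ ($1\le i\le n$, $1\le k\le e_i$), $$P(x;\theta)=\prod_{i=1}^n\prod_{k=1}^{e_i}e^{h^i(\theta)}P_i\big(x^{i,k}e^{h^i(\theta)}\big).$$ *)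

(* Defs.v *)
From HB Require Import structures.
From mathcomp Require Import all_boot all_order all_algebra.
From mathcomp Require Import all_classical all_reals all_analysis.
Set Implicit Arguments.
Unset Strict Implicit.
Unset Printing Implicit Defensive.
Import Order.TTheory GRing.Theory Num.Theory.
Import numFieldNormedType.Exports.
Local Open Scope classical_set_scope.
Local Open Scope ring_scope.

(* The library's sigma-finite instance on \x is keyed to subprobabilities, so
   sigma-finiteness is stated here as a lemma. *)
Lemma sigma_finite_product d1 d2 (T1 : measurableType d1)
    (T2 : measurableType d2) (R : realType)
    (m1 : {sigma_finite_measure set T1 -> \bar R})
    (m2 : {sigma_finite_measure set T2 -> \bar R}) :
  sigma_finite setT (m1 \x m2)%E.
Proof.
have /sigma_finiteP[F [TF ndF Foo]] := sigma_finiteT m1.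
have /sigma_finiteP[G [TG ndG Goo]] := sigma_finiteT m2.
exists (fun n => F n `*` G n).
  rewrite -setXTT TF TG predeqE => -[x y]; split.
    move=> [/= [n _ Fnx] [k _ Gky]]; exists (maxn n k) => //; split.
    - by move: x Fnx; exact/subsetPset/ndF/leq_maxl.
    - by move: y Gky; exact/subsetPset/ndG/leq_maxr.
  by move=> [n _ []/= ? ?]; split; exists n.
move=> k; have [? ?] := Foo k; have [? ?] := Goo k.
split; first exact: measurableX.
by rewrite product_measure1E// lte_mul_pinfty// ge0_fin_numE.
Qed.

(* The library gives n.-tuple T its product sigma-algebra but no product
   measure.  We build it by transporting m1 \x m2 along (x, t) |-> x :: t. *)
Section cons_measure.
Local Open Scope ereal_scope.
Context d (T : measurableType d) (R : realType) (n : nat).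
Variables (m1 : {sigma_finite_measure set T -> \bar R})
          (m2 : {sigma_finite_measure set (n.-tuple T) -> \bar R}).

Definition cons_tup (p : T * n.-tuple T) : n.+1.-tuple T :=
  [the n.+1.-tuple T of p.1 :: p.2].

Definition uncons_tup (t : n.+1.-tuple T) : T * n.-tuple T :=
  (thead t, [tuple of behead t]).

Lemma cons_tupK : cancel cons_tup uncons_tup.
Proof. by case=> x t; congr pair; exact: val_inj. Qed.

Lemma uncons_tupK : cancel uncons_tup cons_tup.
Proof. by move=> t; rewrite [RHS]tuple_eta. Qed.

Lemma measurable_cons_tup : measurable_fun [set: T * n.-tuple T] cons_tup.
Proof. exact: measurable_cons. Qed.

Lemma measurable_uncons_tup : measurable_fun [set: n.+1.-tuple T] uncons_tup.
Proof.
apply/measurable_fun_pairP; split; first exact: measurable_tnth.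
exact: measurable_behead.
Qed.

Definition cons_measure : set (n.+1.-tuple T) -> \bar R :=
  pushforward (m1 \x m2) cons_tup.

#[local] Hint Resolve measurable_cons_tup : core.

Let cons_measure0 : cons_measure set0 = 0.
Proof. exact: measure0. Qed.

Let cons_measure_ge0 A : 0 <= cons_measure A.
Proof. exact: measure_ge0. Qed.

Let cons_measure_sigma_additive : semi_sigma_additive cons_measure.
Proof. exact: measure_semi_sigma_additive. Qed.

HB.instance Definition _ := isMeasure.Build _ _ _ cons_measure
  cons_measure0 cons_measure_ge0 cons_measure_sigma_additive.

Let cons_measure_sigma_finite : sigma_finite setT cons_measure.
Proof.
have [F TF Foo] := sigma_finite_product m1 m2.
exists (fun k => uncons_tup @^-1` F k).
  by rewrite -preimage_bigcup -TF preimage_setT.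
move=> k; have [mF Fk] := Foo k; split.
  by rewrite -[X in measurable X]setTI; exact: measurable_uncons_tup.
rewrite /cons_measure /pushforward -comp_preimage.
rewrite (_ : uncons_tup \o cons_tup = id) ?preimage_id//.
by apply/funext => p; exact: cons_tupK.
Qed.

HB.instance Definition _ := Measure_isSigmaFinite.Build _ _ _ cons_measure
  cons_measure_sigma_finite.

End cons_measure.

(* Lebesgue measure on R^n; for n = 0 it is the unit mass at the empty tuple. *)
Fixpoint lebesgue_tuple (R : realType) (n : nat) :
    {sigma_finite_measure set (n.-tuple (measurableTypeR R)) -> \bar R} :=
  match n with
  | 0 => [the {sigma_finite_measure set _ -> \bar R} of
           @dirac _ (0.-tuple (measurableTypeR R)) [tuple] R]
  | n'.+1 => [the {sigma_finite_measure set _ -> \bar R} of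
           cons_measure (@lebesgue_measure R) (lebesgue_tuple R n')]
  end.

Lemma lebesgue_tuple_box (R : realType) (n : nat)
    (A : 'I_n -> set (measurableTypeR R)) :
  (forall i, measurable (A i)) ->
  lebesgue_tuple R n [set t | forall i, A i (tnth t i)] =
  (\prod_(i < n) lebesgue_measure (A i))%E.
Proof.
elim: n A => [|n IH] A mA.
  rewrite big_ord0 /= /dirac indicE mem_set//=; by case.
rewrite big_ord_recl -IH//= /cons_measure /pushforward.
rewrite -product_measure1E//; last first.
  rewrite (_ : [set t | _] = \bigcap_(i in [set: 'I_n])
      ((@tnth _ (measurableTypeR R) ^~ i) @^-1` A (lift ord0 i))).
    apply: fin_bigcap_measurable => // i _.
    by rewrite -[X in measurable X]setTI; exact: measurable_tnth.
  by apply/seteqP; split=> t /= H i => [_|]; exact: H.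
congr ((_ \x _)%E _); apply/seteqP; split=> -[x t] /=.
  move=> H; split; first by have := H ord0.
  by move=> i; have := H (lift ord0 i); rewrite /cons_tup tnthS.
move=> [Ax At] i; case: (unliftP ord0 i) => [j|] ->.
  by rewrite /cons_tup tnthS; exact: At.
by [].
Qed.

Section fisher.
Context (R : realType) (m : nat).

Definition partial_ (a : 'I_m) (f : 'rV[R]_m -> R) (theta : 'rV[R]_m) : R :=
  'D_(delta_mx 0 a) f theta.

(* Where P x theta = 0 the integrand is 0 whatever the (junk) value of the
   derivatives of ln, because P x theta is a factor. *)
Definition fisher_metric d (T : measurableType d) (mu : set T -> \bar R)
    (X : set T) (P : T -> 'rV[R]_m -> R) (theta : 'rV[R]_m) (a b : 'I_m)
    : \bar R :=
  \int[mu]_(x in X)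
    (P x theta * partial_ a (fun t => ln (P x t)) theta
               * partial_ b (fun t => ln (P x t)) theta)%:E.

End fisher.

Section disjoint_product.
Context (R : realType) (m n : nat) (e : 'I_n -> nat).

Definition spatial : Type := (\sum_(i < n) e i)%N.-tuple (measurableTypeR R).

(* tagnat.Rank i k is the position of x^{i,k} in the concatenated tuple *)
Definition coord (x : spatial) (i : 'I_n) (k : 'I_(e i)) : R :=
  tnth x (tagnat.Rank i k).

Definition odot_dom (X : 'I_n -> set R) : set spatial :=
  [set x | forall (i : 'I_n) (k : 'I_(e i)), X i (coord x k)].

(* The i-th family Q i occurs e i times, each copy in its own variable. *)
Definition odot (Q : 'I_n -> R -> 'rV[R]_m -> R)
    (x : spatial) (theta : 'rV[R]_m) : R :=
  \prod_(i < n) \prod_(k < e i) Q i (coord x k) theta.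

End disjoint_product.

Section one_dim.
Context (R : realType).

Definition is_domain (X : set R) := [/\ X !=set0, open X & connected X].

(* Meant for open X: both conditions are then local to X. *)
Definition C1_on (X : set R) (p : R -> R) :=
  forall x, X x -> derivable p x 1 /\ {for x, continuous (derive1 p)}.

Definition density_on (X : set R) (p : R -> R) :=
  (forall x, X x -> 0 <= p x) /\
  (\int[lebesgue_measure]_(x in X) (p x)%:E = 1)%E.

(* As in fisher_metric, the factor p x makes the integrand 0 where p vanishes. *)
Definition scale_information (X : set R) (p : R -> R) : \bar R :=
  \int[lebesgue_measure]_(x in X)
    (p x * (1 + x * derive1 (fun y => ln (p y)) x) ^+ 2)%:E.

Definition Ecoef (n : nat) (e : 'I_n -> nat) (X : 'I_n -> set R)
    (p : 'I_n -> R -> R) (i j : 'I_n) : \bar R :=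
  if i == j then ((e i)%:R%:E * scale_information (X i) (p i))%E else 0%E.

Definition scaled_density (m : nat) (h : 'rV[R]_m -> R) (p : R -> R)
    (x : R) (theta : 'rV[R]_m) : R :=
  expR (h theta) * p (x * expR (h theta)).

End one_dim.

(* Main.v *)
(* In the flat list of variables x_r the density is a product of rescaled
   densities c_r P_r (c_r x_r) with c_r = e^(h_r), so its log-derivative is
   d_a ln P = sum_r (d_a h_r) w_r(c_r x_r), where w(y) = 1 + y (ln P)'(y).
   Expanding the product of two such sums and applying Fubini, the diagonal
   terms give the claimed formula, while every off-diagonal term contains a
   factor (d_a h_r) int P_r w_r, which vanishes.  Indeed either h_r = 0 on all
   of M and d_a h_r = 0, or the interval X_r is invariant under some, hence
   under every, dilation; in the latter case P w = (y P)' is the derivative at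
   s = 0 of e^s P(y e^s), whose integral over X_r does not depend on s. *)
Require Import Defs.
From mathcomp Require Import all_boot all_order all_algebra.
From mathcomp Require Import all_classical all_reals all_analysis.
From mathcomp Require Import measurable_realfun ring lra.
Set Implicit Arguments.
Unset Strict Implicit.
Unset Printing Implicit Defensive.
Import Order.TTheory GRing.Theory Num.Theory.
Import numFieldNormedType.Exports.
Local Open Scope classical_set_scope.
Local Open Scope ring_scope.

(** * Lebesgue measure and integrals under dilations of the line *)

Section scaling.
Local Open Scope ereal_scope.
Context (R : realType).
Local Notation mu := (@lebesgue_measure R).
Variables (c : R) (c0 : (0 < c)%R).

Let scale (x : measurableTypeR R) : measurableTypeR R := (x * c)%R.

Let mscaler : measurable_fun setT scale.
Proof. exact: measurable_funM. Qed.

(** By uniqueness of Lebesgue measure: [c] times the image of [mu] under the dilation gives every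
    half-open interval its length. *)
Lemma lebesgue_measure_scale (A : set R) : measurable A ->
  mu A = c%:E * mu ((fun x => x * c)%R @^-1` A).
Proof.
move=> mA; pose k := NngNum (ltW c0).
pose nu : {measure set (measurableTypeR R) -> \bar R} :=
  measure_function_pushforward__canonical__measure_function_Measure mu mscaler.
transitivity (mscale k nu A) => //.
apply: (@lebesgue_measure_unique _ (mscale k nu)) => // _ [[a b]] _ <-.
rewrite /= /mscale /= /pushforward.
rewrite (_ : _ @^-1` _ = [set` `](a / c)%R, (b / c)%R]%R]); last first.
  by apply/seteqP; split=> x; rewrite /= !in_itv/= /scale ltr_pdivrMr// ler_pdivlMr.
rewrite !lebesgue_measure_itv/= !lte_fin ltr_pM2r ?invr_gt0//.
case: ifPn => ab; last by rewrite mule0.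
by rewrite -!EFinB -EFinM; congr EFin; field; rewrite gt_eqF.
Qed.

Lemma ge0_integral_scale (f : R -> \bar R) :
  measurable_fun [set: R] f -> (forall x, 0 <= f x) ->
  \int[mu]_x f (x * c)%R = (c^-1)%:E * \int[mu]_x f x.
Proof.
move=> mf f0; pose k := NngNum (ltW c0).
pose nu : {measure set (measurableTypeR R) -> \bar R} :=
  measure_function_pushforward__canonical__measure_function_Measure mu mscaler.
have -> : \int[mu]_x f x = \int[mscale k nu]_x f x.
  by apply: eq_measure_integral => A mA _; exact: lebesgue_measure_scale.
rewrite ge0_integral_mscale// (ge0_integral_pushforward mscaler)//=.
by rewrite muleA -EFinM mulVf ?gt_eqF// mul1e preimage_setT.
Qed.

Lemma integrable_scale (f : R -> \bar R) : mu.-integrable [set: R] f ->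
  mu.-integrable [set: R] (fun x => f (x * c)%R).
Proof.
move=> /integrableP[mf foo]; apply/integrableP; split.
  exact: (measurableT_comp mf mscaler).
rewrite (@ge0_integral_scale (fun x => `|f x|))//; last first.
  exact: measurableT_comp.
by rewrite lte_mul_pinfty// ?lee_fin ?invr_ge0 ?ltW.
Qed.

Lemma integral_scale (f : R -> \bar R) : mu.-integrable [set: R] f ->
  \int[mu]_x f (x * c)%R = (c^-1)%:E * \int[mu]_x f x.
Proof.
move=> intf; have mf := measurable_int _ intf.
rewrite integralE [in RHS]integralE.
under [X in X - _ = _]eq_integral do rewrite (funepos_comp f ( *%R^~ c)).
under [X in _ - X = _]eq_integral do rewrite (funeneg_comp f ( *%R^~ c)).
have p0 (g : R -> \bar R) x : 0 <= g^\+ x by [].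
have n0 (g : R -> \bar R) x : 0 <= g^\- x by [].
transitivity ((c^-1)%:E * \int[mu]_x f^\+ x - (c^-1)%:E * \int[mu]_x f^\- x).
  congr (_ - _).
  - exact: (ge0_integral_scale (measurable_funepos mf) (p0 f)).
  - exact: (ge0_integral_scale (measurable_funeneg mf) (n0 f)).
rewrite -muleBr//.
by apply: fin_num_adde_defl; rewrite fin_numN; exact: integrable_neg_fin_num.
Qed.

Lemma integrable_dilation (f : R -> R) : mu.-integrable setT (EFin \o f) ->
  mu.-integrable setT (fun x => (c * f (x * c))%:E).
Proof.
move=> intf; under eq_fun do rewrite EFinM.
exact/integrableZl/(integrable_scale intf).
Qed.

(** The Jacobian factor cancels the [c^-1] of [integral_scale]. A rescaled density and its products
    with the score and with the squared score all have this form. *)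
Lemma integral_dilation (f : R -> R) : mu.-integrable setT (EFin \o f) ->
  \int[mu]_x (c * f (x * c))%:E = \int[mu]_x (f x)%:E.
Proof.
move=> intf; under eq_integral do rewrite EFinM.
rewrite integralZl//; last exact: (integrable_scale intf).
by rewrite (integral_scale intf) muleA -EFinM divff ?mul1e// gt_eqF.
Qed.

End scaling.

(** * Integrals of products of functions of separate variables *)

Section product_integral.
Local Open Scope ereal_scope.

(** Tonelli: the iterated integral of the absolute value is a product of two finite integrals. *)
Lemma integrable_prodM d1 d2 (T1 : measurableType d1) (T2 : measurableType d2)
    (R : realType) (m1 : {sigma_finite_measure set T1 -> \bar R})
    (m2 : {sigma_finite_measure set T2 -> \bar R}) (f : T1 -> R) (g : T2 -> R) :
  m1.-integrable setT (EFin \o f) -> m2.-integrable setT (EFin \o g) ->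
  (m1 \x m2).-integrable setT (fun z => (f z.1 * g z.2)%:E).
Proof.
move=> intf intg.
have mf : measurable_fun setT f by apply/measurable_EFinP; case/integrableP: intf.
have mg : measurable_fun setT g by apply/measurable_EFinP; case/integrableP: intg.
apply/integrable12ltyP => /=.
  by apply/measurable_EFinP/measurable_funM; exact: measurableT_comp.
under eq_integral => x _.
  under eq_integral do rewrite normrM EFinM.
  rewrite ge0_integralZl//; last by do 2 apply: measurableT_comp.
  over.
rewrite /= ge0_integralZr//.
- by apply: lte_mul_pinfty; rewrite ?integral_ge0 ?ge0_fin_numE//;
    [case/integrableP: intf|exact: integral_ge0|case/integrableP: intg].
- by do 2 apply: measurableT_comp.
- exact: integral_ge0.
Qed.

Lemma integral_prodM d1 d2 (T1 : measurableType d1) (T2 : measurableType d2)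
    (R : realType) (m1 : {sigma_finite_measure set T1 -> \bar R})
    (m2 : {sigma_finite_measure set T2 -> \bar R}) (f : T1 -> R) (g : T2 -> R) :
  m1.-integrable setT (EFin \o f) -> m2.-integrable setT (EFin \o g) ->
  \int[m1 \x m2]_z (f z.1 * g z.2)%:E =
    (\int[m1]_x (f x)%:E) * (\int[m2]_y (g y)%:E).
Proof.
move=> intf intg; rewrite -integral12_prod_meas1; last exact: integrable_prodM.
have g_fin : \int[m2]_y (g y)%:E \is a fin_num by exact: integrable_fin_num.
rewrite /fubini_F /=; under eq_integral => x _.
  under eq_integral do rewrite EFinM.
  rewrite integralZl// -(fineK g_fin).
  over.
by rewrite /= integralZr// fineK.
Qed.

Context (R : realType).
Local Notation mu := (@lebesgue_measure R).

(** Induction on [n] by transport along [cons_tup]. Integrability and value go together, since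
    computing the integral in the inductive step uses integrability of the tail product. *)
Let integral_tuple_prod_subproof n (F : 'I_n -> R -> R) :
  (forall i, mu.-integrable setT (EFin \o F i)) ->
  (lebesgue_tuple R n).-integrable setT
     (fun t => (\prod_(i < n) F i (tnth t i))%:E) /\
  \int[lebesgue_tuple R n]_t (\prod_(i < n) F i (tnth t i))%:E =
     (\prod_(i < n) \int[mu]_x F i x)%R%:E.
Proof.
elim: n F => [|n IH] F intF.
  have -> : (fun t : 0.-tuple (measurableTypeR R) =>
      (\prod_(i < 0) F i (tnth t i))%R%:E) = cst 1.
    by apply/funext => t; rewrite big_ord0.
  split.
    by apply: finite_measure_integrable_cst.
  by rewrite big_ord0 integral_cst//= /dirac indicT mule1.
have [intG EG] := IH (fun i => F (lift ord0 i)) (fun i => intF (lift ord0 i)).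
have mF : measurable_fun [set: n.+1.-tuple (measurableTypeR R)]
    (fun t => (\prod_(i < n.+1) F i (tnth t i))%:E).
  apply/measurable_EFinP/measurable_prod => i _.
  apply: measurableT_comp; last exact: measurable_tnth.
  by apply/measurable_EFinP; case/integrableP: (intF i).
have FE : (fun t => (\prod_(i < n.+1) F i (tnth t i))%:E) \o
      @cons_tup _ (measurableTypeR R) n =
    (fun z => (F ord0 z.1 * \prod_(i < n) F (lift ord0 i) (tnth z.2 i))%:E).
  apply/funext => -[x t] /=; rewrite big_ord_recl; congr (_ * _)%:E.
  by apply: eq_bigr => i _; rewrite /cons_tup tnthS.
have int2 : (mu \x lebesgue_tuple R n).-integrable setT
    ((fun t => (\prod_(i < n.+1) F i (tnth t i))%:E) \o
       @cons_tup _ (measurableTypeR R) n).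
  by rewrite FE; exact: (@integrable_prodM _ _ _ _ _ _ _ _ _ (intF ord0) intG).
split.
  exact:
    (integrable_pushforward (@measurable_cons_tup _ _ n) mF int2 measurableT).
transitivity (\int[mu \x lebesgue_tuple R n]_z
   (F ord0 z.1 * \prod_(i < n) F (lift ord0 i) (tnth z.2 i))%:E).
  rewrite -FE.
  exact: (integral_pushforward (@measurable_cons_tup _ _ n) mF int2 measurableT).
rewrite (@integral_prodM _ _ _ _ _ _ _ _ _ (intF ord0) intG) EG.
rewrite big_ord_recl EFinM; congr (_ * _).
by rewrite /Rintegral fineK//; exact: (integrable_fin_num measurableT (intF ord0)).
Qed.

Lemma integrable_tuple_prod n (F : 'I_n -> R -> R) :
  (forall i, mu.-integrable setT (EFin \o F i)) ->
  (lebesgue_tuple R n).-integrable setT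
     (fun t => (\prod_(i < n) F i (tnth t i))%:E).
Proof. by move=> /integral_tuple_prod_subproof[]. Qed.

Lemma integral_tuple_prod n (F : 'I_n -> R -> R) :
  (forall i, mu.-integrable setT (EFin \o F i)) ->
  \int[lebesgue_tuple R n]_t (\prod_(i < n) F i (tnth t i))%:E =
     (\prod_(i < n) \int[mu]_x F i x)%R%:E.
Proof. by move=> /integral_tuple_prod_subproof[]. Qed.

End product_integral.

(** * Expansion of the information integral of a product *)

Section product_information.
Context (R : realType).
Local Notation mu := (@lebesgue_measure R).

(* Expanding the two sums gives one product integral for each pair (i, j); off
   the diagonal it contains the factor [\int f i * s i]. *)
Lemma product_information n (f s : 'I_n -> R -> R) (A B : 'I_n -> R) :
  (forall i, mu.-integrable setT (EFin \o f i)) ->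
  (forall i, mu.-integrable setT (fun x => (f i x * s i x)%:E)) ->
  (forall i, mu.-integrable setT (fun x => (f i x * s i x ^+ 2)%:E)) ->
  (forall i, \int[mu]_x f i x = 1) ->
  (forall i, A i * (\int[mu]_x (f i x * s i x)) = 0) ->
  (\int[lebesgue_tuple R n]_t
    ((\prod_(i < n) f i (tnth t i)) * (\sum_(i < n) A i * s i (tnth t i))
       * (\sum_(i < n) B i * s i (tnth t i)))%:E =
   (\sum_(i < n) A i * B i * (\int[mu]_x (f i x * s i x ^+ 2)))%:E)%E.
Proof.
move=> intf intfs intfs2 f1 Afs.
(* The exponent is 2, 1 or 0 according as [k] equals both, exactly one or neither of [i] and [j], so
   every term of the expansion is a product of one-variable functions. *)
pose F (i j k : 'I_n) x := f k x * s k x ^+ ((k == i) + (k == j)).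
have intF i j k : mu.-integrable setT (EFin \o F i j k).
  rewrite /F; case: eqVneq => _; case: eqVneq => _ /=; rewrite ?addn0 ?add0n.
  - exact: intfs2.
  - exact: intfs.
  - exact: intfs.
  - by under eq_fun do rewrite expr0 mulr1; exact: intf.
have prodF i j t : \prod_(k < n) F i j k (tnth t k) =
    (\prod_(k < n) f k (tnth t k)) * s i (tnth t i) * s j (tnth t j).
  have prods l : \prod_(k < n) s k (tnth t k) ^+ (k == l) = s l (tnth t l).
    rewrite (bigD1 l)//= eqxx big1 ?mulr1// => k kl.
    by rewrite (negbTE kl).
  rewrite big_split/= -mulrA; congr (_ * _).
  under eq_bigr do rewrite exprD.
  by rewrite big_split/= !prods.
transitivity (\int[lebesgue_tuple R n]_t \sum_(z : 'I_n * 'I_n)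
    ((A z.1 * B z.2)%:E * (\prod_(k < n) F z.1 z.2 k (tnth t k))%:E))%E.
  apply: eq_integral => t _; under [RHS]eq_bigr do rewrite -EFinM.
  rewrite sumEFin; congr EFin.
  rewrite -(pair_bigA _ (fun i j => A i * B j * \prod_(k < n) F i j k (tnth t k)))/=.
  rewrite -mulrA mulr_suml mulr_sumr; apply: eq_bigr => i _.
  rewrite mulrA mulr_sumr; apply: eq_bigr => j _.
  by rewrite prodF; ring.
rewrite integral_sum//; last first.
  by move=> z; apply: integrableZl => //; exact: integrable_tuple_prod.
transitivity (\sum_(z : 'I_n * 'I_n)
    (A z.1 * B z.2 * \prod_(k < n) \int[mu]_x F z.1 z.2 k x)%:E)%E.
  apply: eq_bigr => z _; rewrite integralZl//; last exact: integrable_tuple_prod.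
  by rewrite integral_tuple_prod// EFinM.
rewrite sumEFin; congr EFin.
rewrite -(pair_bigA _ (fun i j => A i * B j * \prod_(k < n) \int[mu]_x F i j k x))/=.
(* For fixed [i] only [j = i] survives, and there the factors with [k != i] integrate to 1. *)
apply: eq_bigr => i _; rewrite (bigD1 i)//= [X in _ + X]big1 => [|j ji].
  rewrite addr0; congr (_ * _); rewrite (bigD1 i)//= big1 ?mulr1 => [|k ki].
    by rewrite /F eqxx.
  rewrite (_ : F i i k = f k)//.
  by apply/funext => x; rewrite /F (negbTE ki) mulr1.
rewrite (bigD1 i)//= (_ : F i j i = fun x => f i x * s i x); last first.
  by apply/funext => x; rewrite /F eqxx eq_sym (negbTE ji).
by rewrite mulrA [A i * B j * _]mulrAC Afs !mul0r.
Qed.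

End product_information.

(** * The score of one density in the logarithmic scale parameter *)

Section one_dim_score.
Context (R : realType) (X : set R) (p : R -> R).
Local Notation mu := (@lebesgue_measure R).

(** On [X] this is the derivative of [y * p y], and also the derivative at [s = 0] of
    [expR s * p (y * expR s)]. *)
Definition scale_derivative : R -> R := (fun y => p y + y * derive1 p y) \_ X.

(* [x / 0 = 0], so this is [0] off [X] and where [p] vanishes. *)
Definition score (y : R) : R := scale_derivative y / (p \_ X) y.

Hypotheses (oX : open X) (pC1 : C1_on X p) (pdens : density_on X p).

Let mX : measurable (X : set (measurableTypeR R)).
Proof. exact: open_measurable. Qed.

Lemma density_restrict_ge0 y : 0 <= (p \_ X) y.
Proof.
by rewrite patchE; case: ifPn => // /set_mem Xy; exact: pdens.1.
Qed.

Lemma density_continuous y : X y -> {for y, continuous p}.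
Proof.
move=> /pC1[dp _]; apply: differentiable_continuous.
exact/derivable1_diffP.
Qed.

Lemma continuous_scale_derivative y : X y ->
  {for y, continuous (fun z => p z + z * derive1 p z)}.
Proof.
move=> Xy; have [_ cdp] := pC1 Xy.
have cid : {for y, continuous (@id R)} by exact: cvg_id.
exact: (continuousD (density_continuous Xy) (continuousM cid cdp)).
Qed.

(** A zero of the nonnegative [p] in the open set [X] is an interior minimum. This makes
    [density_score] true at zeros of [p] as well, where [score] is a division by 0. *)
Lemma density_derive_eq0 y : X y -> p y = 0 -> derive1 p y = 0.
Proof.
move=> Xy py0; have /nbhs_ballP[r /= r0 yrX] := open_nbhs_nbhs (conj oX Xy).
have itvX t : t \in `](y - r), (y + r)[ -> X t.
  rewrite in_itv/= => /andP[yt ty]; apply: yrX; rewrite /ball/= ltr_norml.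
  by apply/andP; split; lra.
have yab : y - r <= y + r by lra.
have yin : y \in `](y - r), (y + r)[ by rewrite in_itv/=; apply/andP; split; lra.
have dp t : t \in `](y - r), (y + r)[ -> derivable p t 1 by move/itvX/pC1 => [].
have pmin t : t \in `](y - r), (y + r)[ -> p y <= p t.
  by move/itvX => Xt; rewrite py0; exact: pdens.1.
by have [_ <-] := derive1_at_min yab dp yin pmin; rewrite derive1E.
Qed.

Lemma measurable_density_restrict : measurable_fun setT (p \_ X).
Proof.
apply/(measurable_restrictT _ mX); apply: open_continuous_measurable_fun => //.
by move=> y /set_mem; exact: density_continuous.
Qed.

Lemma measurable_scale_derivative : measurable_fun setT scale_derivative.
Proof.
apply/(measurable_restrictT _ mX); apply: open_continuous_measurable_fun => //.
by move=> y /set_mem; exact: continuous_scale_derivative.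
Qed.

Lemma density_score y : (p \_ X) y * score y = scale_derivative y.
Proof.
rewrite /score /scale_derivative !patchE; case: ifPn => [/set_mem Xy|_].
  have [py0|py0] := eqVneq (p y) 0; last by rewrite mulrC divfK.
  by rewrite py0 mul0r density_derive_eq0// mulr0 addr0.
by rewrite mul0r.
Qed.

Lemma scoreE y : X y -> 0 < p y -> score y = 1 + y * (derive1 p y / p y).
Proof.
move=> Xy py; rewrite /score /scale_derivative !patchE mem_set//.
by rewrite mulrDl divff ?gt_eqF// mulrA.
Qed.

Lemma derive1_ln_density y : X y -> 0 < p y ->
  derive1 (fun z => ln (p z)) y = derive1 p y / p y.
Proof.
move=> Xy py; have [dp _] := pC1 Xy.
have dpy : is_derive y 1 p (derive1 p y).
  by split; [exact: dp|rewrite derive1E].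
have dln := is_derive1_ln py.
by rewrite derive1E derive_val mulrC.
Qed.

(** Both integrands vanish where [p] does; where [p] is positive, the derivative of its logarithm is
    the quotient in [scoreE]. *)
Lemma scale_information_score : scale_information X p =
  (\int[mu]_y ((p \_ X) y * score y ^+ 2)%:E)%E.
Proof.
rewrite /scale_information integral_mkcond; apply: eq_integral => y _.
rewrite !patchE.
case: ifPn => [/set_mem Xy|_]; last by rewrite mul0r.
have [->|py0] := eqVneq (p y) 0; first by rewrite !mul0r.
have py : 0 < p y by rewrite lt_def py0 pdens.1.
by rewrite scoreE// derive1_ln_density.
Qed.

Lemma measurable_score : measurable_fun setT score.
Proof.
apply: measurable_funM; first exact: measurable_scale_derivative.
(* The inverse agrees with the real power of exponent -1 on nonnegative numbers, 0 included, and
   that power is measurable. *)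
have -> : (fun y => ((p \_ X) y)^-1) = (@powR R ^~ (-1)) \o (p \_ X).
  by apply/funext => y /=; rewrite powR_inv1 ?density_restrict_ge0.
apply: measurableT_comp; first exact: measurable_powR.
exact: measurable_density_restrict.
Qed.

Lemma integrable_density : mu.-integrable setT (EFin \o p \_ X).
Proof.
apply/integrableP; split.
  by apply/measurable_EFinP; exact: measurable_density_restrict.
under eq_integral => y _ do rewrite /= ger0_norm ?density_restrict_ge0//.
rewrite -[X in (integral _ _ X < _)%E]/(EFin \o p \_ X) -restrict_EFin.
by rewrite -integral_mkcond pdens.2 ltry.
Qed.

Lemma integral_density : \int[mu]_y (p \_ X) y = 1.
Proof. by rewrite -Rintegral_mkcond /Rintegral pdens.2. Qed.

Hypothesis info_fin : (scale_information X p < +oo)%E.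

Lemma integrable_density_score2 :
  mu.-integrable setT (fun y => ((p \_ X) y * score y ^+ 2)%:E).
Proof.
apply/integrableP; split.
  apply/measurable_EFinP/measurable_funM; first exact: measurable_density_restrict.
  by apply: measurable_funX; exact: measurable_score.
apply: le_lt_trans info_fin; rewrite scale_information_score le_eqVlt.
apply/orP; left; apply/eqP; apply: eq_integral => y _ /=.
congr EFin; apply/ger0_norm/mulr_ge0; last exact: sqr_ge0.
exact: density_restrict_ge0.
Qed.

Lemma scale_information_fineE :
  scale_information X p = (\int[mu]_y ((p \_ X) y * score y ^+ 2))%:E.
Proof.
rewrite scale_information_score /Rintegral fineK//.
exact: (integrable_fin_num measurableT integrable_density_score2).
Qed.

(* [|w| <= 1 + w ^ 2] *)
Lemma integrable_scale_derivative :
  mu.-integrable setT (EFin \o scale_derivative).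
Proof.
have int2 := integrableD measurableT integrable_density integrable_density_score2.
apply: le_integrable int2 => //.
  by apply/measurable_EFinP; exact: measurable_scale_derivative.
move=> y _ /=; rewrite lee_fin -density_score normrM.
have P0 := density_restrict_ge0 y.
rewrite (ger0_norm P0) (ger0_norm (addr_ge0 P0 (mulr_ge0 P0 (sqr_ge0 _)))).
rewrite -[X in X + _]mulr1 -mulrDr ler_wpM2l// -real_normK ?num_real//.
by nra.
Qed.

End one_dim_score.

(** * Vanishing of the mean score on a dilation-invariant domain *)

Section mean_score.
Context (R : realType) (X : set R) (p : R -> R).
Local Notation mu := (@lebesgue_measure R).
Hypotheses (oX : open X) (pC1 : C1_on X p) (pdens : density_on X p).

(** Serves both along the orbit of [x] under dilations, in [integral_orbit], and at [s = h theta],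
    in the chain rule on the parameter space. *)
Lemma is_derive_scaled_density (x s : R) : X (x * expR s) ->
  is_derive s 1 (fun t => expR t * p (x * expR t))
    (expR s * scale_derivative X p (x * expR s)).
Proof.
move=> Xs; have [dp _] := pC1 Xs.
have dx : is_derive s 1 (fun t => x * expR t) (x * expR s).
  have := @is_deriveZ R R R expR x s 1 (expR s) (is_derive_expR s).
  by [].
have dpx : is_derive (x * expR s) 1 p (derive1 p (x * expR s)).
  by split; [exact: dp|rewrite derive1E].
have dc := @is_derive1_comp R p (fun t => x * expR t) s _ _ dpx dx.
have dm : is_derive s 1 (fun t => expR t * p (x * expR t)) _ :=
  @is_deriveM R R expR _ s 1 _ _ (is_derive_expR s) dc.
apply: (is_derive_eq dm).
by rewrite /scale_derivative patchE mem_set//= /GRing.scale /=; ring.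
Qed.

Hypothesis Xscale : forall s x, X x -> X (x * expR s).
Hypothesis info_fin : (scale_information X p < +oo)%E.

Let in_scale s x : (x * expR s \in X) = (x \in X).
Proof.
apply/idP/idP => /set_mem Xx; apply/mem_set; last exact: Xscale.
by have := Xscale (- s) Xx; rewrite -mulrA -expRD subrr expR0 mulr1.
Qed.

Let G := scale_derivative X p.

(** The fundamental theorem of calculus for [expR s * p (x * expR s)]. If [x] is outside [X], so is
    its whole orbit, and both sides are 0. *)
Let integral_orbit x :
  (\int[mu]_(s in `[0%R, 1%R]) (expR s * G (x * expR s))%:E =
   (expR 1 * (p \_ X) (x * expR 1))%:E - ((p \_ X) x)%:E)%E.
Proof.
have [Xx|Xx] := boolP (x \in X); last first.
  rewrite !patchE in_scale (negbTE Xx) mulr0 sube0.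
  rewrite (_ : (fun s => _) = cst 0%E) ?integral0//.
  apply/funext => s.
  by rewrite /G /scale_derivative patchE in_scale (negbTE Xx) mulr0.
have dF s := is_derive_scaled_density (Xscale s (set_mem Xx)).
have cF : continuous (fun t => expR t * p (x * expR t)).
  move=> s; apply: differentiable_continuous; apply/derivable1_diffP.
  by have [] := dF s.
have cG : continuous (fun s => expR s * G (x * expR s)).
  move=> s; apply: continuousM; first exact: continuous_expR.
  rewrite (_ : (fun t => G _) =
    (fun z => p z + z * derive1 p z) \o (fun t => x * expR t)); last first.
    by apply/funext => t; rewrite /G /scale_derivative patchE in_scale Xx.
  apply: continuous_comp; last first.
    exact: (continuous_scale_derivative pC1 (Xscale s (set_mem Xx))).
  by apply: continuousM; [exact: cst_continuous|exact: continuous_expR].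
rewrite (@continuous_FTC2 _ _ (fun t => expR t * p (x * expR t)))//.
- by rewrite expR0 mulr1 mul1r !patchE in_scale Xx.
- exact: continuous_subspaceT.
- split.
  + by move=> s _; have [] := dF s.
  + exact/cvg_at_right_filter/cF.
  + exact/cvg_at_left_filter/cF.
- by move=> s _; rewrite derive1E; have [_ ->] := dF s.
Qed.

(* The integral over [0 <= s <= 1] and over [x] of the [s]-derivative of
   [expR s * p (x * expR s)] can be computed in two ways: integrating over [s]
   first gives [1 - 1], integrating over [x] first gives the left-hand side. *)
Lemma integral_scale_derivative : \int[mu]_y scale_derivative X p y = 0.
Proof.
have intG : mu.-integrable setT (EFin \o G) by exact: integrable_scale_derivative.
have mG : measurable_fun setT G by exact: measurable_scale_derivative.
(* The indicator confines the time [z.1] to the unit interval, so that Fubini can be applied on the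
   whole plane. *)
pose phi (z : measurableTypeR R * measurableTypeR R) : \bar R :=
  (\1_(`[0%R, 1%R]%classic : set R) z.1 * (expR z.1 * G (z.2 * expR z.1)))%:E.
have mexp1 : measurable_fun setT
    (fun z : measurableTypeR R * measurableTypeR R => expR z.1).
  by apply: measurableT_comp; [exact: measurable_expR|exact: measurable_fst].
have mphi : measurable_fun setT phi.
  apply/measurable_EFinP; apply: measurable_funM.
    by apply: measurableT_comp; [exact: measurable_indic|exact: measurable_fst].
  apply: measurable_funM => //; apply: measurableT_comp => //.
  by apply: measurable_funM => //; exact: measurable_snd.
have G_fin : (\int[mu]_y (G y)%:E)%E \is a fin_num.
  exact: (integrable_fin_num measurableT intG).
have indic01 : (\int[mu]_s (\1_(`[0%R, 1%R]%classic : set R) s)%:E = 1 :> \bar R)%E.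
  have := lebesgue_measure_itv `[0 : R, 1]; rewrite /= lte_fin ltr01 sube0 => <-.
  by rewrite integral_indic// setIT.
have int_scaled s := integrable_dilation (expR_gt0 s) intG.
have inner s := integral_dilation (expR_gt0 s) intG.
have intphi : (mu \x mu)%E.-integrable setT phi.
  apply/integrable12ltyP => //.
  (* Dilation invariance of the integral makes the inner integral of the absolute value the same at
     all times of the unit interval. *)
  have absphi x : (\int[mu]_y `|phi (x, y)| =
      (\1_(`[0%R, 1%R]%classic : set R) x)%:E * \int[mu]_y `|G y|%:E)%E.
    under eq_integral => y _.
      rewrite /phi /= normrM EFinM ger0_norm// normrM EFinM ger0_norm ?expR_ge0//.
      over.
    have mabs : measurable_fun setT (fun y : R => `|G y|%:E).
      by apply/measurable_EFinP; exact: measurableT_comp.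
    have mabsx : measurable_fun setT (fun y : R => `|G (y * expR x)|%:E).
      apply/measurable_EFinP; apply: measurableT_comp => //.
      by apply: measurableT_comp => //; exact: measurable_funM.
    rewrite /= ge0_integralZl//; last exact: emeasurable_funM.
    congr (_ * _)%E; rewrite ge0_integralZl// ?lee_fin ?expR_ge0//.
    rewrite (ge0_integral_scale (expR_gt0 x) mabs)//.
    by rewrite muleA -EFinM divff ?mul1e// gt_eqF// expR_gt0.
  under eq_integral do rewrite absphi.
  have [_ absG] := integrableP _ _ _ intG.
  rewrite ge0_integralZr//; last exact: integral_ge0.
    by rewrite indic01 mul1e.
  by apply/measurable_EFinP; exact: measurable_indic.
have time_first y : (\int[mu]_s phi (s, y) =
    (expR 1 * (p \_ X) (y * expR 1))%:E - ((p \_ X) y)%:E)%E.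
  rewrite -integral_orbit [RHS]integral_mkcond; apply: eq_integral => s _.
  rewrite /phi /= indicE patchE.
  by case: ifPn => sin; rewrite ?mul1r ?mul0r.
have space_first : (\int[mu]_s \int[mu]_y phi (s, y) = \int[mu]_y (G y)%:E)%E.
  transitivity (\int[mu]_s ((\1_(`[0%R, 1%R]%classic : set R) s)%:E
      * (fine (\int[mu]_y (G y)%:E))%:E))%E.
    apply: eq_integral => s _; rewrite fineK// -(inner s) -integralZl//.
  rewrite integralZr//; last exact: integrable_indic_itv.
  by rewrite indic01 mul1e fineK.
have intP : mu.-integrable setT (EFin \o p \_ X) by exact: integrable_density.
have intP1 := integrable_dilation (expR_gt0 1) intP.
have P1 : (\int[mu]_y ((p \_ X) y)%:E = 1)%E.
  rewrite -(integral_density pdens) /Rintegral fineK//.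
  exact: (integrable_fin_num measurableT intP).
rewrite /Rintegral -space_first (Fubini intphi).
under eq_integral do rewrite time_first.
rewrite integralB_EFin//.
by rewrite (integral_dilation (expR_gt0 1) intP) P1 subee.
Qed.

End mean_score.

(** Iterating the given dilation and its inverse moves [x] to points of [X] on both sides of
    [x * expR s], and [X] is an interval. This supplies the hypothesis [Xscale] above. *)
Lemma connected_scale_closed (R : realType) (X : set R) (t : R) :
  connected X -> t != 0 -> [set x * expR t | x in X] = X ->
  forall s x, X x -> X (x * expR s).
Proof.
move=> /connected_intervalP itvX t0 tX s x Xx.
have Xt y : X y -> X (y * expR t) by move=> Xy; rewrite -tX; exists y.
have XtN y : X y -> X (y * expR (- t)).
  rewrite -{1}tX => -[z Xz <-].
  by rewrite -mulrA -expRD subrr expR0 mulr1.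
(* The sign of [t] is unknown, so closure under both dilations is restated with its absolute
   value. *)
have Xabs y : X y -> X (y * expR `|t|) /\ X (y * expR (- `|t|)).
  by move=> Xy; case: (ger0P t) => _; rewrite ?opprK; split; auto.
have Xn n : X (x * expR (n%:R * `|t|)) /\ X (x * expR (- (n%:R * `|t|))).
  elim: n => [|n [Xn XnN]]; first by rewrite mul0r oppr0 expR0 mulr1.
  rewrite -natr1 mulrDl mul1r opprD !expRD !mulrA.
  by split; [exact: (Xabs _ Xn).1|exact: (Xabs _ XnN).2].
have t_gt0 : 0 < `|t| by rewrite normr_gt0.
pose n := Num.trunc (`|s| / `|t|).
have sn : `|s| <= n.+1%:R * `|t|.
  by rewrite -ler_pdivrMr// ltW// truncnS_gt.
have [Xn1 Xn2] := Xn n.+1.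
move: sn; rewrite ler_norml -ler_expR -[X in _ && X]ler_expR => /andP[s1 s2].
(* Multiplication by a negative [x] reverses the order and swaps the two endpoints. *)
have [x0|x0] := leP 0 x.
  by apply: (itvX _ _ Xn2 Xn1); rewrite !ler_wpM2l.
by apply: (itvX _ _ Xn1 Xn2); rewrite !ler_wnM2l// ltW.
Qed.

(** * Logarithmic derivatives in the parameter [theta] *)

Lemma is_derive_comp_real (R : realType) (V : normedModType R) (h : V -> R)
    (g : R -> R) (v x : V) (dg : R) :
  differentiable h x -> is_derive (h x) 1 g dg ->
  is_derive x v (g \o h) ('D_v h x * dg).
Proof.
move=> dh [dgx gE].
have diffg : differentiable g (h x) by exact/derivable1_diffP.
have diffgh : differentiable (g \o h) x by exact: differentiable_comp.
split; first exact: diff_derivable.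
by rewrite !deriveE// diff_comp//= diff1E// derive1E gE.
Qed.

Section log_derivative.
Context (R : realType) (m : nat) (X : set R) (p : R -> R) (h : 'rV[R]_m -> R).
Variables (theta : 'rV[R]_m) (x : R).
Hypotheses (pC1 : C1_on X p) (dh : differentiable h theta).
Hypotheses (Xx : X (x * expR (h theta))).

(** By continuity at [theta]. Positivity nearby is what allows the logarithm of a product to be
    split before differentiating. *)
Lemma near_scaled_density_gt0 : 0 < scaled_density h p x theta ->
  \forall t \near theta, 0 < scaled_density h p x t.
Proof.
move=> px; have [ds _] := is_derive_scaled_density pC1 Xx.
suff cf : {for theta, continuous (scaled_density h p x)}.
  exact: (cvgr_gt (scaled_density h p x theta) cf 0 px).
apply: differentiable_continuous.
apply: (@differentiable_comp _ _ _ _ h (fun s => expR s * p (x * expR s))) => //.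
exact/derivable1_diffP.
Qed.

(** Chain rule through [h]; the prefactor [expR (h theta)] cancels in the logarithmic derivative,
    leaving the score at the dilated point. *)
Lemma is_derive_ln_scaled_density (v : 'rV[R]_m) :
  0 < scaled_density h p x theta ->
  is_derive theta v (fun t => ln (scaled_density h p x t))
    ('D_v h theta * score X p (x * expR (h theta))).
Proof.
move=> px.
apply: (is_derive_comp_real (g := fun s => ln (expR s * p (x * expR s)))) => //.
have dln := @is_derive1_comp R (@ln R) (fun s => expR s * p (x * expR s)) _ _ _
  (is_derive1_ln px) (is_derive_scaled_density pC1 Xx).
apply: (is_derive_eq dln).
rewrite /score /scaled_density patchE mem_set// mulrC.
have p0 : p (x * expR (h theta)) != 0.
  by apply: contraTneq px => p0; rewrite /scaled_density p0 mulr0 ltxx.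
by field; rewrite p0 gt_eqF ?expR_gt0.
Qed.

End log_derivative.

Lemma ln_prod (R : realType) (n : nat) (f : 'I_n -> R) :
  (forall i, 0 < f i) -> ln (\prod_(i < n) f i) = \sum_(i < n) ln (f i).
Proof.
move=> f0; suff [//] : ln (\prod_(i < n) f i) = \sum_(i < n) ln (f i) /\
  0 < \prod_(i < n) f i.
elim/big_rec2: _ => [|i y1 y2 _ [<- y2_gt0]]; first by rewrite ln1.
by rewrite lnM ?posrE// mulr_gt0.
Qed.

Lemma derive_ln_prod (R : realType) (m n : nat) (f : 'I_n -> 'rV[R]_m -> R)
    (theta v : 'rV[R]_m) (df : 'I_n -> R) :
  (forall i, \forall t \near theta, 0 < f i t) ->
  (forall i, is_derive theta v (fun t => ln (f i t)) (df i)) ->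
  'D_v (fun t => ln (\prod_(i < n) f i t)) theta = \sum_(i < n) df i.
Proof.
move=> f_gt0 lnf.
(* The two functions need agree only near [theta], where all the finitely many factors are
   positive. *)
have -> : 'D_v (fun t => ln (\prod_(i < n) f i t)) theta =
    'D_v (\sum_(i < n) (fun t => ln (f i t))) theta.
  apply: near_eq_derive.
  have : \forall t \near theta, forall i, 0 < f i t by exact: filter_forall f_gt0.
  by apply: filterS => t ft; rewrite ln_prod// fct_sumE.
by have [_] := is_derive_sum lnf.
Qed.

(** * Flattening the doubly indexed variables *)

Section blocks.
Context (n : nat) (e : 'I_n -> nat).

(** The pairs [(i, k)] correspond bijectively to the flat positions [r], and [tagnat.sig1 r]
    recovers the block [i]. *)
Lemma big_tagnat (T : Type) (idx : T) (op : Monoid.com_law idx)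
    (F : 'I_n -> 'I_(\sum_(i < n) e i) -> T) :
  \big[op/idx]_(i < n) \big[op/idx]_(k < e i) F i (tagnat.Rank i k) =
  \big[op/idx]_(r < \sum_(i < n) e i) F (tagnat.sig1 r) r.
Proof.
rewrite sig_big_dep/= (reindex _ tagnat.sig_bij_on)/=.
by apply: eq_bigr => r _; congr (F _ _); exact: tagnat.sig2K.
Qed.

Lemma odotE (R : realType) (m : nat) (Q : 'I_n -> R -> 'rV[R]_m -> R)
    (x : spatial R e) (theta : 'rV[R]_m) :
  odot Q x theta =
  \prod_(r < \sum_(i < n) e i) Q (tagnat.sig1 r) (tnth x r) theta.
Proof. exact: (big_tagnat _ (fun i r => Q i (tnth x r) theta)). Qed.

Lemma odot_domE (R : realType) (X : 'I_n -> set R) (x : spatial R e) :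
  odot_dom X x <-> forall r, X (tagnat.sig1 r) (tnth x r).
Proof.
split=> [Xx r|Xx i k].
  by have := Xx _ (tagnat.sig2 r); rewrite /Defs.coord tagnat.sig2K.
by have := Xx (tagnat.Rank i k); rewrite tagnat.Rank1K.
Qed.

End blocks.

(** For an index whose [h] vanishes throughout [M]: its domain may admit no nontrivial dilation and
    its mean score may be nonzero, so the cross terms must vanish through this factor. *)
Lemma partial_eq0 (R : realType) (m : nat) (M : set 'rV[R]_m)
    (h : 'rV[R]_m -> R) (theta : 'rV[R]_m) (a : 'I_m) :
  open M -> M theta -> (forall t, M t -> h t = 0) -> partial_ a h theta = 0.
Proof.
move=> oM Mtheta h0; rewrite /partial_ (@near_eq_derive _ _ _ h (cst 0)).
  exact: derive_cst.
by apply: filterS (open_nbhs_nbhs (conj oM Mtheta)) => t /h0.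
Qed.

(** * The metric assembled from one-variable integrals *)

Unset Implicit Arguments.

Theorem corollary4p10 (R : realType) (m n : nat) (M : set 'rV[R]_m)
    (X : 'I_n -> set R) (p : 'I_n -> R -> R) (h : 'I_n -> 'rV[R]_m -> R)
    (e : 'I_n -> nat) :
  open M ->
  (forall i, is_domain (X i)) ->
  (forall i, C1_on (X i) (p i)) ->
  (forall i, density_on (X i) (p i)) ->
  (forall i theta, M theta -> differentiable (h i) theta) ->
  (forall i, (0 < e i)%N) ->
  (forall i theta, M theta ->
     [set x * expR (h i theta) | x in X i] = X i) ->
  (forall i, (scale_information (X i) (p i) < +oo)%E) ->
  forall theta, M theta -> forall a b : 'I_m,
    fisher_metric (lebesgue_tuple R (\sum_(i < n) e i)) (odot_dom X)
      (odot (fun i => scaled_density (h i) (p i))) theta a b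
    = (\sum_(i < n) \sum_(j < n)
        (partial_ a (h i) theta * partial_ b (h j) theta)%:E
          * Ecoef e X p i j)%E.
Proof.
move=> oM domX pC1 pdens dh _ Xinv info_fin theta Mtheta a b.
have oX i : open (X i) by case: (domX i).
pose c i := expR (h i theta).
have c_gt0 i : 0 < c i by exact: expR_gt0.
have XcE i x : (x * c i \in X i) = (x \in X i).
  apply/idP/idP => /set_mem Xx; apply/mem_set; last first.
    by rewrite -(Xinv i theta Mtheta); exists x.
  move: Xx; rewrite -{1}(Xinv i theta Mtheta) => -[y Xy yx].
  by rewrite -(mulIf (lt0r_neq0 (c_gt0 i)) yx).
(* [f i] is the density of one variable of block [i] at the fixed [theta], extended by 0 so that
   integrals run over whole spaces; [s i] is its score. *)
pose f i x := c i * (p i \_ (X i)) (x * c i).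
pose s i x := score (X i) (p i) (x * c i).
pose J i := \int[lebesgue_measure]_y ((p i \_ (X i)) y * score (X i) (p i) y ^+ 2).
have JE i : scale_information (X i) (p i) = (J i)%:E.
  exact: scale_information_fineE.
have intP i := integrable_density (oX i) (pC1 i) (pdens i).
have intPw i := integrable_scale_derivative (oX i) (pC1 i) (pdens i) (info_fin i).
have intPw2 i := integrable_density_score2 (oX i) (pC1 i) (pdens i) (info_fin i).
(* Both products are dilations of functions not involving [theta], so their integrals do not depend
   on [theta]. *)
have fsE i : (fun x => f i x * s i x) =
    (fun x => c i * scale_derivative (X i) (p i) (x * c i)).
  by apply/funext => x; rewrite /f -mulrA density_score.
have fs2E i : (fun x => f i x * s i x ^+ 2) =
    (fun x => c i *
       (fun y => (p i \_ (X i)) y * score (X i) (p i) y ^+ 2) (x * c i)).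
  by apply/funext => x; rewrite /f -mulrA.
have intf i : lebesgue_measure.-integrable setT (EFin \o f i).
  exact: integrable_dilation.
have intfs i : lebesgue_measure.-integrable setT (EFin \o (fun x => f i x * s i x)).
  by rewrite fsE; exact: integrable_dilation.
have intfs2 i : lebesgue_measure.-integrable setT
    (EFin \o (fun x => f i x * s i x ^+ 2)).
  by rewrite fs2E; exact: (integrable_dilation (c_gt0 i) (intPw2 i)).
have f1 i : \int[lebesgue_measure]_x f i x = 1.
  by rewrite /Rintegral integral_dilation//; exact: integral_density.
have fs2J i : \int[lebesgue_measure]_x (f i x * s i x ^+ 2) = J i.
  by rewrite fs2E /Rintegral (integral_dilation (c_gt0 i) (intPw2 i)).
have Afs i : partial_ a (h i) theta * \int[lebesgue_measure]_x (f i x * s i x) = 0.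
  (* A nonzero value of [h i] anywhere in [M], not only at [theta], provides the nontrivial
     dilation. *)
  have [[t [Mt ht]]|h0] := pselect (exists t, M t /\ h i t != 0).
    rewrite fsE /Rintegral integral_dilation//.
    have [_ _ cX] := domX i; have Xscale := connected_scale_closed cX
      ht (Xinv i t Mt).
    by rewrite [fine _]integral_scale_derivative ?mulr0.
  rewrite (partial_eq0 _ oM Mtheta) ?mul0r// => t Mt.
  by apply: contrapT => /eqP ht; apply: h0; exists t.
pose i_ := @tagnat.sig1 n e.
transitivity (\int[lebesgue_tuple R (\sum_(i < n) e i)]_t
    ((\prod_r f (i_ r) (tnth t r))
     * (\sum_r partial_ a (h (i_ r)) theta * s (i_ r) (tnth t r))
     * (\sum_r partial_ b (h (i_ r)) theta * s (i_ r) (tnth t r)))%:E)%E.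
  rewrite /fisher_metric integral_mkcond; apply: eq_integral => x _.
  rewrite patchE; case: ifPn => [/set_mem/odot_domE Xx|Xx]; last first.
    (* Outside the domain some coordinate leaves its [X], and the corresponding factor [f] is 0. *)
    have [r Xr] : exists r, ~ X (i_ r) (tnth x r).
      apply/existsNP => Xr; move/negP: Xx; apply; apply/mem_set.
      exact/odot_domE.
    rewrite (bigD1 r)//= {1}/f patchE XcE memNset// mulr0.
    by rewrite !mul0r.
  have fE r : f (i_ r) (tnth x r) =
      scaled_density (h (i_ r)) (p (i_ r)) (tnth x r) theta.
    by rewrite /f patchE XcE mem_set.
  have -> : odot (fun i => scaled_density (h i) (p i)) x theta =
      \prod_r f (i_ r) (tnth x r).
    by rewrite odotE; apply: eq_bigr => r _; rewrite fE.
  (* At a zero of the product both integrands are 0, whatever the derivatives of [ln] are there;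
     otherwise every factor is positive and the logarithm may be differentiated termwise. *)
  have [/existsP[r /eqP fr0]|f_neq0] := boolP [exists r, f (i_ r) (tnth x r) == 0].
    by rewrite (bigD1 r)//= fr0 !mul0r.
  have f_gt0 r : 0 < scaled_density (h (i_ r)) (p (i_ r)) (tnth x r) theta.
    rewrite -fE lt_def; apply/andP; split.
      by move/existsPn: f_neq0; exact.
    by rewrite mulr_ge0 ?density_restrict_ge0// ltW.
  have Xxc r : X (i_ r) (tnth x r * expR (h (i_ r) theta)).
    by apply/set_mem; rewrite XcE; exact/mem_set.
  have dlnP v : partial_ v
      (fun t => ln (odot (fun i => scaled_density (h i) (p i)) x t)) theta =
      \sum_r partial_ v (h (i_ r)) theta * s (i_ r) (tnth x r).
    rewrite /partial_; under eq_fun do rewrite odotE.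
    apply: derive_ln_prod => r.
      exact: (near_scaled_density_gt0 (pC1 _) (dh _ _ Mtheta) (Xxc r) (f_gt0 r)).
    exact: (is_derive_ln_scaled_density (pC1 _) (dh _ _ Mtheta) (Xxc r) _ (f_gt0 r)).
  by rewrite !dlnP.
rewrite (product_information _ (fun r => intf (i_ r)) (fun r => intfs (i_ r))
  (fun r => intfs2 (i_ r)) (fun r => f1 (i_ r)) (fun r => Afs (i_ r))).
transitivity ((\sum_r
    partial_ a (h (i_ r)) theta * partial_ b (h (i_ r)) theta * J (i_ r))%:E).
  by congr EFin; apply: eq_bigr => r _; rewrite fs2J.
(* Back from positions to blocks: block [i] contributes [e i] equal terms, which is the factor [e i]
   of [Ecoef]. *)
rewrite -(@big_tagnat _ e _ _ +%R (fun i _ =>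
  partial_ a (h i) theta * partial_ b (h i) theta * J i)).
rewrite -sumEFin; apply: eq_bigr => i _.
rewrite (bigD1 i)//= [X in (_ + X)%E]big1 => [|j ji]; last first.
  by rewrite /Ecoef eq_sym (negbTE ji) mule0.
rewrite adde0 /Ecoef eqxx JE -!EFinM sumr_const card_ord.
by congr EFin; rewrite -mulr_natr; ring.
Qed.
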